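(* For any integer $n\geq 0$, $$\big(NT_{\mathrm{eo}}(1,5,10n)-NT_{\mathrm{eo}}(4,5,10n)\big)+2\big(NT_{\mathrm{eo}}(2,5,10n)-NT_{\mathrm{eo}}(3,5,10n)\big)\equiv 0\pmod{10},$$ $$\big(NT_{\mathrm{eo}}(1,5,10n+8)-NT_{\mathrm{eo}}(4,5,10n+8)\big)+2\big(NT_{\mathrm{eo}}(2,5,10n+8)-NT_{\mathrm{eo}}(3,5,10n+8)\big)\equiv 0\pmod{20}.$$
   Context: A partition of $n$ is a finite weakly decreasing sequence of positive integers (its parts) with sum $n$; the empty partition is the unique partition of $0$. $\mathcal{O}(\lambda)$ denotes the number of odd parts of $\lambda$, counted with multiplicity. $\mathfrak{EO}$ is the set of partitions in which every even part is less than each odd part (a condition that holds vacuously if all parts have the same parity, or if the partition is empty). $\overline{\mathfrak{EO}}_n$ is the set of partitions $\lambda$ of $n$ in $\mathfrak{EO}$ in which only the largest even part, if any, appears an odd number of times: if $\lambda$ has an even part, then its largest even part has odd multiplicity, and every other part size that occurs has even multiplicity; if $\lambda$ has no even part, every part size that occurs has even multiplicity. The even-odd crank of $\lambda\in\mathfrak{EO}$ is $\mathrm{eoc}(\lambda)=(\text{the largest even part of }\lambda)-\mathcal{O}(\lambda)$, where the largest even part is taken to be $0$ if $\lambda$ has no even parts. $NT_{\mathrm{eo}}(k,m,n)$ denotes the total number of odd parts among all partitions in $\overline{\mathfrak{EO}}_n$ whose even-odd crank is congruent to $k$ modulo $m$, i.e. $NT_{\mathrm{eo}}(k,m,n)=\sum_{\lambda\in\overline{\mathfrak{EO}}_n,\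 \mathrm{eoc}(\lambda)\equiv k\ (\mathrm{mod}\ m)}\mathcal{O}(\lambda)$. *)

(* Defs.v *)
From mathcomp Require Import all_boot all_order all_algebra.

Set Implicit Arguments.
Unset Strict Implicit.
Unset Printing Implicit Defensive.

Import Order.TTheory GRing.Theory Num.Theory.

Definition is_partition (n : nat) (l : seq nat) : bool :=
  [&& sorted geq l, all (fun x => 0 < x) l & sumn l == n].

Definition num_odd_parts (l : seq nat) : nat := count odd l.

Definition in_EO (l : seq nat) : bool :=
  all (fun x => all (fun y => ~~ odd x && odd y ==> (x < y)) l) l.

(* The empty maximum is 0, hence the value is 0 when there is no even part. *)
Definition largest_even (l : seq nat) : nat := \max_(x <- l | ~~ odd x) x.

(* When l has no even part, largest_even l = 0 is not a part, so the last
   clause makes every multiplicity even. *)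
Definition in_EObar (n : nat) (l : seq nat) : bool :=
  [&& is_partition n l, in_EO l
    & all (fun x => odd (count_mem x l) == (x == largest_even l)) l].

Definition eoc (l : seq nat) : int :=
  ((largest_even l)%:Z - (num_odd_parts l)%:Z)%R.

(* Partitions of n as elements of a finite type: a partition of n has at most n
   parts, each at most n (see partition_bseq below). *)
Definition bseq_parts (n : nat) (s : n.-bseq 'I_n.+1) : seq nat :=
  [seq nat_of_ord i | i <- s].

Definition NTeo (k : int) (m n : nat) : nat :=
  \sum_(s : n.-bseq 'I_n.+1 | in_EObar n (bseq_parts s)
                              && (eoc (bseq_parts s) == k %[mod m])%Z)
     num_odd_parts (bseq_parts s).

Lemma bseq_parts_inj (n : nat) : injective (@bseq_parts n).
Proof. by move=> s t /(inj_map val_inj) /val_inj. Qed.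

Lemma partition_bseq (n : nat) (l : seq nat) :
  is_partition n l -> exists s : n.-bseq 'I_n.+1, bseq_parts s = l.
Proof.
case/and3P=> _ pos /eqP sum_l.
have size_l : size l <= n.
  rewrite -sum_l; elim: l pos {sum_l} => //= x l IH /andP[x0 /IH].
  by rewrite -add1n; apply: leq_add.
have le_l x : x \in l -> x <= n.
  rewrite -sum_l; elim: l {pos sum_l size_l} => //= y l IH.
  rewrite inE => /predU1P[->|/IH xl]; first exact: leq_addr.
  exact: leq_trans xl (leq_addl _ _).
have size_s : size (map (@inord n) l) <= n by rewrite size_map.
exists (Bseq size_s); rewrite /bseq_parts /= -map_comp -[RHS]map_id.
by apply/eq_in_map => x /le_l xn; rewrite /= inordK.
Qed.

(* Main.v *)
Require Import Defs.
From mathcomp Require Import all_boot all_order all_algebra all_field.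
From mathcomp Require Import zify ring.

(* Let [2 a] be the largest even part of a partition counted here, [2 j] the number
   of its odd parts and [2 m] its size. By the q-binomial theorem the generating
   function of the monomials s^a t^j q^m is
     F(s, t) = (s t q^2; q^2) / ((s q; q^2) (t q; q^2)),
   where (x; b) denotes the product of the 1 - x b^i over i >= 0. Since F is
   symmetric in s and t, the statistics a and j can be exchanged; the crank being
   2 (a - j), the combination in the theorem becomes a sum over partitions whose
   terms modulo 5 depend only on a - j modulo 5.
   At a primitive fifth root of unity z,
     F(z, 1/z) (q^5; q^5) = T(z^2, q) T(z^4, q^2),
   with T(w, q) = (w q; q) (q / w; q) (q; q), and by the Jacobi triple product
     (1 - w) T(w, q) = sum_(i >= 0) (-1)^i q^(i (i + 1) / 2) (w^-i - w^(i + 1)).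
   Reading the coefficients of q^m for m = 0 and m = 4 modulo 5 shows that the four
   nonzero residue classes of a - j modulo 5 are equinumerous, and that for m = 4
   the zero class has the same size as well. This gives the divisibility by 5; the
   remaining power of 2 follows from a + j = m modulo 2 and the symmetry.
   Power series in q are truncated by computing in a ring where q is nilpotent, so
   that every product is finite and every identity exact. *)

Set Implicit Arguments.
Unset Strict Implicit.
Unset Printing Implicit Defensive.

Import GRing.Theory Num.Theory.
Local Open Scope ring_scope.

(** * Finite q-products and the q-binomial theorem *)

Section Nilpotent.
Variables (A : comNzRingType) (N : nat).
Implicit Types x y b q w v : A.

Definition qpoch x b n : A := \prod_(i < n) (1 - x * b ^+ i).

Definition geom x : A := \sum_(k < N) x ^+ k.

Lemma mul_geom x : x ^+ N = 0 -> (1 - x) * geom x = 1.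
Proof.
by move=> x0; rewrite -opprB mulNr -subrX1 x0 sub0r opprK.
Qed.

Lemma expr_nil x n : x ^+ N = 0 -> (N <= n)%N -> x ^+ n = 0.
Proof. by move=> x0 /subnK <-; rewrite exprD x0 mulr0. Qed.

Lemma exprMnil x y : x ^+ N = 0 -> (y * x) ^+ N = 0.
Proof. by move=> x0; rewrite exprMn x0 mulr0. Qed.

Lemma qpochS x b n : qpoch x b n.+1 = qpoch x b n * (1 - x * b ^+ n).
Proof. exact: big_ord_recr. Qed.

Lemma qpoch0 x b : qpoch x b 0 = 1.
Proof. exact: big_ord0. Qed.

Lemma qpoch_stable x b n : b ^+ N = 0 -> (N <= n)%N -> qpoch x b n = qpoch x b N.
Proof.
move=> b0 /subnKC <-; elim: (n - N)%N => [|k IH]; rewrite ?addn0 //.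
by rewrite addnS qpochS IH (expr_nil b0) ?leq_addr // mulr0 subr0 mulr1.
Qed.

Lemma qpoch_mul_geom x b n : x ^+ N = 0 ->
  qpoch x b n * \prod_(i < n) geom (x * b ^+ i) = 1.
Proof.
move=> x0; rewrite -big_split big1 //= => i _.
by apply: mul_geom; rewrite mulrC exprMnil.
Qed.

Lemma mulr_qpoch_inj x b n : x ^+ N = 0 -> injective (fun z => z * qpoch x b n).
Proof.
move=> x0; apply: (@can_inj _ _ _ (fun z => z * \prod_(i < n) geom (x * b ^+ i))).
by move=> z; rewrite -mulrA qpoch_mul_geom // mulr1.
Qed.

(** The recursion on [h] stands for the quotient of (y; b)_a by (b; b)_a without a division. It
    gives [H z * (1 - z) = (1 - z * y) * H (z * b)] for the series [H]; iterating [N] times from [x]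
    ends at [H 0 = 1], because [b ^+ N = 0]. *)
Lemma q_binomial x y b (h : nat -> A) :
    x ^+ N = 0 -> b ^+ N = 0 -> h 0 = 1 ->
    (forall a, h a.+1 * (1 - b ^+ a.+1) = h a * (1 - y * b ^+ a)) ->
  (\sum_(a < N) x ^+ a * h a) * qpoch x b N = qpoch (x * y) b N.
Proof.
move=> x0 b0 h0 hS; pose H z := \sum_(a < N) z ^+ a * h a.
have N0 : (0 < N)%N by case: (N) x0 => // /eqP; rewrite oner_eq0.
have HE z : z ^+ N = 0 -> H z * (1 - z) = (1 - z * y) * H (z * b).
  move=> z0; have E: H z - H (z * b) = z * H z - z * y * H (z * b).
    transitivity (\sum_(a < N.+1) z ^+ a * (h a * (1 - b ^+ a))).
      rewrite big_ord_recr /= z0 mul0r addr0 -sumrB; apply: eq_bigr => a _.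
      by rewrite exprMn; ring.
    rewrite big_ord_recl expr0 subrr !mulr0 add0r !mulr_sumr -sumrB.
    by apply: eq_bigr => a _; rewrite lift0 hS exprS exprMn; ring.
  have -> : H z * (1 - z) = (H z - H (z * b)) - z * H z + H (z * b) by ring.
  by rewrite E; ring.
have Hn n : H x * qpoch x b n = qpoch (x * y) b n * H (x * b ^+ n).
  elim: n => [|n IH]; first by rewrite !qpoch0 expr0 !(mulr1, mul1r).
  rewrite !qpochS mulrA IH -!mulrA HE; last by rewrite mulrC exprMnil.
  by rewrite -!mulrA -exprSr [y * _]mulrC.
rewrite -/(H x) Hn b0 mulr0 /H -(prednK N0) big_ord_recl h0 big1 => [|i _].
  by rewrite expr0 addr0 !mulr1.
by rewrite lift0 exprS !mul0r.
Qed.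

(** * The Jacobi triple product *)

(* The Gaussian binomial coefficient of [2 n + 1] over [n - i], zero for [n < i]. *)
Fixpoint jcoef q n i : A :=
  if n is m.+1 then
    (1 + q ^+ (2 * m).+2) * jcoef q m i + q ^+ (m + i).+2 * jcoef q m i.+1
    + (if i is i'.+1 then q ^+ (m - i') * jcoef q m i' else q ^+ m.+1 * jcoef q m 0)
  else (i == 0)%:R.

Lemma jcoef_gt q n i : (n < i)%N -> jcoef q n i = 0.
Proof.
elim: n i => [|n IH] [|i] //= lt_ni.
by rewrite !IH ?mulr0 ?addr0 //; lia.
Qed.

(** Induction on [n]: the new factor is [1 + Q ^+ 2 - Q * (w + v)] with [Q = q ^+ n.+1], and
    multiplication by [w + v] sends [u i = v ^+ i - w ^+ i.+1] to the sum of its two neighbours.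
    Since [w] is the inverse of [v], the neighbour of [u 0] on the left is [- u 0], whence the
    special clause of [jcoef] at [i = 0]. *)
Lemma finite_triple_product q w v n : w * v = 1 ->
  (1 - w) * \prod_(i < n) ((1 - w * q ^+ i.+1) * (1 - v * q ^+ i.+1)) =
  \sum_(i < n.+1) (-1) ^+ i * q ^+ 'C(i.+1, 2) * (v ^+ i - w ^+ i.+1) * jcoef q n i.
Proof.
move=> wv; elim: n => [|n IH].
  by rewrite big_ord0 big_ord1 bin_small //= !expr0 expr1; ring.
pose u i := v ^+ i - w ^+ i.+1.
have uS i : (w + v) * u i.+1 = u i.+2 + u i.
  rewrite /u mulrDl !mulrBr [w * v ^+ _]mulrC [v * w ^+ _]mulrC.
  have -> : v ^+ i.+1 * w = v ^+ i by rewrite exprSr -mulrA [v * w]mulrC wv mulr1.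
  have -> : w ^+ i.+2 * v = w ^+ i.+1 by rewrite exprSr -mulrA wv mulr1.
  by rewrite -!exprS; ring.
have u0 : (w + v) * u 0%N = u 1%N - u 0%N.
  rewrite /u !expr0 !expr1 mulrBr mulr1 mulrDl [v * w]mulrC wv expr2; ring.
pose T i := 'C(i.+1, 2).
have TS i : T i.+1 = (T i + i.+1)%N by rewrite /T binS bin1 addnC.
have T0 : T 0%N = 0%N by [].
have T1 : T 1%N = 1%N by [].
pose g (c : nat -> A) i : A := (-1) ^+ i * q ^+ T i * u i * c i.
rewrite big_ord_recr /= mulrA IH.
set Q := q ^+ n.+1.
have -> : (1 - w * Q) * (1 - v * Q) = 1 + q ^+ (2 * n).+2 - Q * (w + v).
  transitivity (1 - Q * (w + v) + Q * Q * (w * v)); first by ring.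
  by rewrite wv mulr1 -exprD (_ : n.+1 + n.+1 = (2 * n).+2)%N; [ring|lia].
rewrite [in LHS](eq_bigr (fun i : 'I_n.+1 => g (jcoef q n) i)) //.
(* Padding by vanishing terms brings both halves of the product to the range of the next sum. *)
have ext c k : (forall i, (n < i)%N -> c i = 0) ->
    \sum_(i < n.+1) g c i = \sum_(i < n.+1 + k) g c i.
  move=> c0; rewrite big_split_ord /= [X in _ + X]big1 ?addr0 // => i _.
  by rewrite /g c0 ?mulr0 //; lia.
rewrite mulrBr.
have -> : (\sum_(i < n.+1) g (jcoef q n) i) * (1 + q ^+ (2 * n).+2) =
    \sum_(i < n.+2) (-1) ^+ i * q ^+ T i * u i * ((1 + q ^+ (2 * n).+2) * jcoef q n i).
  rewrite (ext _ 1%N); last exact: jcoef_gt.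
  by rewrite addn1 mulr_suml; apply: eq_bigr => i _; rewrite /g; ring.
have -> : (\sum_(i < n.+1) g (jcoef q n) i) * (Q * (w + v)) =
   - \sum_(i < n.+2) (-1) ^+ i * q ^+ T i * u i * (q ^+ (n + i).+2 * jcoef q n i.+1
    + (if (i : nat) is i'.+1 then q ^+ (n - i') * jcoef q n i' else Q * jcoef q n 0)).
  rewrite big_ord_recl mulrDl.
  have -> : g (jcoef q n) (@ord0 n) * (Q * (w + v)) = Q * jcoef q n 0 * (u 1%N - u 0%N).
    by rewrite /g /= T0 -u0 !expr0; ring.
  rewrite mulr_suml.
  have -> : \sum_(i < n) g (jcoef q n) i.+1 * (Q * (w + v)) =
     \sum_(i < n.+2) (-1) ^+ i.+1 * q ^+ T i.+1 * jcoef q n i.+1 * Q * (u i.+2 + u i).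
    rewrite [RHS]big_ord_recr [in RHS]big_ord_recr /= !jcoef_gt // ?mulr0 !mul0r !addr0.
    by apply: eq_bigr => i _; rewrite /g -uS; ring.
  rewrite (eq_bigr (fun i : 'I_n.+2 => (-1) ^+ i.+1 * q ^+ T i.+1 * jcoef q n i.+1 * Q * u i.+2
      - (-1) ^+ i * q ^+ T i * u i * (q ^+ (n + i).+2 * jcoef q n i.+1))); last first.
    move=> i _; rewrite TS exprS; have -> : (n + i).+2 = (n.+1 + i.+1)%N by lia.
    by rewrite /Q !exprD; ring.
  rewrite sumrB; under [X in _ = - X]eq_bigr do rewrite mulrDr.
  rewrite big_split /= [RHS]opprD [RHS]addrC addrA; congr (_ - _).
  rewrite -sumrN.
  rewrite [RHS]big_ord_recl [in RHS]big_ord_recl /=.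
  rewrite [in LHS]big_ord_recr [in LHS]big_ord_recr /= (jcoef_gt q (ltnSn n)).
  rewrite (@jcoef_gt q n n.+2) // ?mulr0 !mul0r !addr0.
  rewrite [X in _ = _ + (_ + X)](eq_bigr (fun i : 'I_n =>
      (-1) ^+ i.+1 * q ^+ T i.+1 * jcoef q n i.+1 * Q * u i.+2)); last first.
    move=> i _; rewrite /bump /= !add0n !add1n TS.
    have -> : Q = q ^+ (n - i.+1) * q ^+ i.+2 by rewrite -exprD; congr (_ ^+ _);
      have := ltn_ord i; lia.
    by rewrite !exprS !exprD !exprS; ring.
  by rewrite T0 T1 subn0 /Q !exprS !expr0; ring.
rewrite opprK -big_split; apply: eq_bigr => i _ /=.
by rewrite -mulrDr addrA.
Qed.
End Nilpotent.

(** The quotient formula for the Gaussian binomial, cleared of denominators. Along the recursion,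
    the neighbouring coefficients are brought over common products; a polynomial identity
    remains. *)
Lemma jcoefE (A : comNzRingType) (q : A) n i : (i <= n)%N ->
  jcoef q n i * (qpoch q q (n - i) * qpoch q q (n + i).+1) = qpoch q q (2 * n).+1.
Proof.
pose P := qpoch q q.
have PS k : P k.+1 = P k * (1 - q ^+ k.+1) by rewrite /P qpochS -exprS.
rewrite -/P; elim: n i => [|n IH] i le_in.
  by case: i le_in => // _; rewrite /= mul1r /P qpoch0 mul1r.
(* Multiplied by [1 - q ^+ (n - k)], the formula at [k.+1] extends to [k = n], where both sides
   vanish. *)
have IHS k : (k <= n)%N -> jcoef q n k.+1 * (P (n - k)%N * P (n + k).+2)
    = P (2 * n).+1 * (1 - q ^+ (n - k)).
  rewrite leq_eqVlt => /predU1P[->|lt_kn].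
    by rewrite subnn expr0 subrr mulr0 jcoef_gt ?mul0r.
  by rewrite -(IH k.+1) // -(subnSK lt_kn) PS !addnS; ring.
have -> : P (2 * n.+1).+1 = P (2 * n).+1
    * (1 - q ^+ n.+1 * q ^+ n.+1) * (1 - q * q ^+ n.+1 * q ^+ n.+1).
  rewrite mulnS !addSn add0n PS [in LHS]PS -exprS -!exprD.
  by congr (_ * (1 - q ^+ _) * (1 - q ^+ _)); lia.
have -> // : jcoef q n.+1 i =
    (1 + q ^+ n.+1 * q ^+ n.+1) * jcoef q n i + q ^+ (n + i).+2 * jcoef q n i.+1
    + (if i is i'.+1 then q ^+ (n - i') * jcoef q n i' else q ^+ n.+1 * jcoef q n 0).
  by rewrite -exprD /= (_ : n.+1 + n.+1 = (2 * n).+2)%N //; lia.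
case: i le_in => [|i] le_in.
  have := IHS 0%N isT; have := IH 0%N isT.
  rewrite !addn0 !subn0 !PS !exprS => E0 E1.
  set x := P n in E0 E1 *; set Y := q ^+ n in E0 E1 *.
  transitivity ((jcoef q n 0 * (x * (x * (1 - q * Y)))) * (1 + (q * Y) ^+ 2 + q * Y) *
     (1 - q * Y) * (1 - q * (q * Y))
    + jcoef q n 1 * (x * (x * (1 - q * Y) * (1 - q * (q * Y)))) * q * q * Y
      * (1 - q * Y)); first by ring.
  by rewrite E0 E1; ring.
rewrite subSS.
have E2 : P (n.+1 + i.+1).+1 = P (n + i).+1 * (1 - q ^+ (n + i).+2) * (1 - q ^+ (n + i).+3).
  by rewrite -!PS addSnnS !addnS.
have := IH i le_in; rewrite ltnS leq_eqVlt in le_in.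
case/predU1P: le_in => [-> | lt_in] E0.
  rewrite subnn (jcoef_gt q (ltnSn n)) (@jcoef_gt _ q n n.+2) // !mulr0 !add0r expr0 mul1r.
  have -> : (n.+1 + n.+1).+1 = (n + n).+3 by lia.
  by rewrite PS [P (n + n).+2]PS -E0 subnn !exprS exprD; ring.
have := IH i.+1 lt_in; have := IHS i.+1 lt_in.
rewrite E2; move: E0; set G := P (2 * n).+1.
have Eq : q ^+ n = q ^+ (n - i.+1) * q ^+ i * q.
  by rewrite -exprD -exprSr; congr (_ ^+ _); lia.
rewrite -(subnSK lt_in) !addnS !PS !exprS exprD Eq.
set Z := q ^+ (n - _); set W := q ^+ i; set p := P _; set p' := P _ => E0 E1 E3.
set X := Z * W * q * W in E0 E1 E3 *.
transitivity (
  jcoef q n i.+1 * (p * (p' * (1 - q * X) * (1 - q * (q * X))))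
    * ((1 + (q * (Z * W * q)) ^+ 2) * (1 - q * Z) * (1 - q * (q * (q * X))))
  + jcoef q n i.+2 * (p * (p' * (1 - q * X) * (1 - q * (q * X)) * (1 - q * (q * (q * X)))))
    * (q * (q * (q * X)) * (1 - q * Z))
  + jcoef q n i * (p * (1 - q * Z) * (p' * (1 - q * X)))
    * (q * Z * (1 - q * (q * X)) * (1 - q * (q * (q * X))))); first by ring.
by rewrite E0 E1 E3 /X; ring.
Qed.

(** The finite identity at [n = 2 * N]. Terms with index at least [N] contain a vanishing power of
    [q]; for the others all products in [jcoefE] have at least [N] factors, hence are stable, and
    [jcoef] is the inverse of [qpoch q q N]. *)
Lemma triple_product (A : comNzRingType) N (q w v : A) : q ^+ N = 0 -> w * v = 1 ->
  (1 - w) * (qpoch (w * q) q N * qpoch (v * q) q N * qpoch q q N) =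
  \sum_(i < N) (-1) ^+ i * q ^+ 'C(i.+1, 2) * (v ^+ i - w ^+ i.+1).
Proof.
move=> q0 wv; pose n := (2 * N)%N.
have stab x k : (N <= k)%N -> qpoch x q N = qpoch x q k.
  by move=> ?; rewrite (qpoch_stable x q0).
have E : \prod_(i < n) ((1 - w * q ^+ i.+1) * (1 - v * q ^+ i.+1)) =
    qpoch (w * q) q N * qpoch (v * q) q N.
  rewrite !(stab _ n); try by rewrite /n; lia.
  by rewrite -big_split; apply: eq_bigr => i _ /=; rewrite exprS !mulrA.
rewrite mulrA -E finite_triple_product // mulr_suml.
have -> : n.+1 = (N + N.+1)%N by rewrite /n; lia.
rewrite big_split_ord /= [X in _ + X]big1 ?addr0 => [|i _]; last first.
  have -> : q ^+ 'C((N + i).+1, 2) = 0.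
    apply: expr_nil q0 _; rewrite -[(N + i).+1]addn1 addn1 binS bin1.
    exact: leq_trans (leq_addr i N) (leq_addl _ _).
  by rewrite mulr0 !mul0r.
apply: eq_bigr => i _; rewrite -[RHS]mulr1 -mulrA; congr (_ * _).
apply: (@mulr_qpoch_inj _ N q q N q0); rewrite /= mul1r -mulrA.
have lt_iN := ltn_ord i.
rewrite [RHS](stab q (2 * n).+1) ?/n; last by lia.
by rewrite -(@jcoefE _ q n i) -?stab // /n; lia.
Qed.

(** * The crank generating function as a product *)

(* Generating function of the partitions under study, with weight
   [s ^ a * t ^ j * q ^ m] for largest even part [2 a], [2 j] odd parts and size
   [2 m]: the factors with [i < a] are the pairs of even parts [2 i + 2], those with
   [a <= i] the pairs of odd parts [2 i + 1]. *)
Definition crank_series (A : comNzRingType) N (s t q : A) : A :=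
  \sum_(a < N) (s * q) ^+ a *
    \prod_(i < N) geom N (if (i < a)%N then q ^+ (2 * i).+2 else t * q ^+ (2 * i).+1).

Section CrankProduct.
Variables (A : comNzRingType) (N : nat) (q : A).
Hypothesis q0 : q ^+ N = 0.

Let xq0 x k : (x * q ^+ k.+1) ^+ N = 0.
Proof. by rewrite exprMnil // exprS mulrC exprMnil. Qed.

(** In the term of index [a], multiplying by (t q; q^2) cancels the factors with [a <= i] and leaves
    (t q; q^2)_a / (q^2; q^2)_a, the coefficient [h a] of the q-binomial theorem. *)
Lemma crank_series_product (s t : A) :
  crank_series N s t q * (qpoch (s * q) (q ^+ 2) N * qpoch (t * q) (q ^+ 2) N) =
  qpoch (s * t * q ^+ 2) (q ^+ 2) N.
Proof.
have b0 : (q ^+ 2) ^+ N = 0 by rewrite -[q ^+ 2]mul1r xq0.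
pose h a := qpoch (t * q) (q ^+ 2) a *
  \prod_(i < a) geom N (q ^+ 2 * (q ^+ 2) ^+ i).
have -> : s * t * q ^+ 2 = (s * q) * (t * q) by rewrite expr2; ring.
rewrite -(@q_binomial _ N (s * q) (t * q) (q ^+ 2) h) //; first last.
- move=> a; rewrite /h qpochS big_ord_recr /= -exprS.
  rewrite -!mulrA [geom _ _ * _]mulrC mul_geom; last by rewrite exprAC b0 expr0n.
  by rewrite mulr1; ring.
- by rewrite /h qpoch0 big_ord0 mulr1.
- by rewrite -[q]expr1 xq0.
rewrite mulrCA mulrC; congr (_ * _).
rewrite /crank_series mulr_suml; apply: eq_bigr => a _.
rewrite -mulrA; congr (_ * _); rewrite /h.
have le_aN := ltnW (ltn_ord a).
have -> : \prod_(i < N) geom N (if (i < a)%N then q ^+ (2 * i).+2 else t * q ^+ (2 * i).+1)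
    = \prod_(i < a) geom N (q ^+ 2 * (q ^+ 2) ^+ i)
      * \prod_(a <= i < N) geom N (t * q * (q ^+ 2) ^+ i).
  rewrite -(big_mkord xpredT (fun i =>
    geom N (if (i < a)%N then q ^+ (2 * i).+2 else t * q ^+ (2 * i).+1))).
  rewrite -(big_mkord xpredT (fun i => geom N (q ^+ 2 * (q ^+ 2) ^+ i))).
  rewrite (big_cat_nat _ le_aN) //=; congr (_ * _); apply: eq_big_nat => i.
    by case/andP=> _ ->; rewrite -exprM -exprD.
  by case/andP=> le_ai _; rewrite ltnNge le_ai -exprM -mulrA -exprS.
have -> : qpoch (t * q) (q ^+ 2) N = qpoch (t * q) (q ^+ 2) a
      * \prod_(a <= i < N) (1 - t * q * (q ^+ 2) ^+ i).
  rewrite /qpoch -!(big_mkord xpredT (fun i => 1 - t * q * (q ^+ 2) ^+ i)).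
  by rewrite (big_cat_nat _ le_aN).
rewrite mulrACA [X in X * _]mulrC -[RHS]mulr1; congr (_ * _).
rewrite -big_split big1_seq //= => i _.
by rewrite mulrC mul_geom // -mulrA -exprM -exprS xq0.
Qed.
End CrankProduct.

Lemma qpoch_even_odd (A : comNzRingType) (x q : A) n :
  qpoch x q (2 * n) = qpoch x (q ^+ 2) n * qpoch (x * q) (q ^+ 2) n.
Proof.
elim: n => [|n IH]; first by rewrite !qpoch0 mulr1.
by rewrite mulnS !qpochS IH -exprM !exprS; ring.
Qed.

Lemma quintic_root5 (R : comNzRingType) (z : R) :
  z ^+ 4 + z ^+ 3 + z ^+ 2 + z + 1 = 0 -> z ^+ 5 = 1.
Proof.
by move=> z0; apply/eqP; rewrite -subr_eq0 -(mulr0 (z - 1)) -z0; apply/eqP; ring.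
Qed.

(** Here [s * t = 1], so the numerator is (q^2; q^2). Splitting (z q; q) and (z^4 q; q) by parity of
    the index cancels the denominator, and the surviving factors form two triple products, with
    parameters [z ^+ 2] at [q] and [z ^+ 4] at [q ^+ 2]. *)
Lemma crank_series_quintic (A : comNzRingType) N (q z : A) :
    q ^+ N = 0 -> z ^+ 4 + z ^+ 3 + z ^+ 2 + z + 1 = 0 ->
  (1 - z ^+ 2) * (1 - z ^+ 4) * (crank_series N z (z ^+ 4) q * qpoch (q ^+ 5) (q ^+ 5) N) =
  (\sum_(i < N) (-1) ^+ i * q ^+ 'C(i.+1, 2) * (z ^+ 3 ^+ i - z ^+ 2 ^+ i.+1)) *
  (\sum_(i < N) (-1) ^+ i * (q ^+ 2) ^+ 'C(i.+1, 2) * (z ^+ i - z ^+ 4 ^+ i.+1)).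
Proof.
move=> q0 z0.
have z5 := quintic_root5 z0.
have q20 : (q ^+ 2) ^+ N = 0 by rewrite exprAC q0 expr0n.
rewrite -(@triple_product _ N _ (z ^+ 2) (z ^+ 3)) -?exprD //.
rewrite -(@triple_product _ N _ (z ^+ 4) z) // -?exprSr //.
have split_qpoch x : qpoch (x * q) q N = qpoch (x * q) (q ^+ 2) N * qpoch (x * q ^+ 2) (q ^+ 2) N.
  rewrite -(@qpoch_stable _ N _ q (2 * N)) //; last by lia.
  by rewrite qpoch_even_odd -mulrA -expr2.
have := crank_series_product q0 z (z ^+ 4); rewrite -exprS z5 mul1r => GE.
(* Factorwise, [1 - x ^+ 5] is the product of [1 - z ^+ k * x] over [k < 5]; conjugate factors are
   paired. *)
have -> : qpoch (q ^+ 5) (q ^+ 5) N = qpoch q q N * qpoch (z * q) q N * qpoch (z ^+ 2 * q) q N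
    * qpoch (z ^+ 3 * q) q N * qpoch (z ^+ 4 * q) q N.
  rewrite -!big_split; apply: eq_bigr => i _ /=.
  rewrite -!exprS -!mulrA -!exprS -exprM mulnC exprM.
  set x := q ^+ i.+1.
  have -> : z * (z * (z * (z * x))) = z ^+ 4 * x by ring.
  have -> : z * (z * (z * x)) = z ^+ 3 * x by ring.
  have zE : z ^+ 4 = - (z ^+ 3 + z ^+ 2 + z + 1).
    by apply/eqP; rewrite -addr_eq0 -z0; apply/eqP; ring.
  have E1 : (1 - z * x) * (1 - z ^+ 4 * x) = 1 - (z + z ^+ 4) * x + z ^+ 5 * x ^+ 2 by ring.
  have E2 : (1 - z * (z * x)) * (1 - z ^+ 3 * x) = 1 - (z ^+ 2 + z ^+ 3) * x + z ^+ 5 * x ^+ 2.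
    by ring.
  transitivity ((1 - x) * (((1 - z * x) * (1 - z ^+ 4 * x))
     * ((1 - z * (z * x)) * (1 - z ^+ 3 * x)))); last by ring.
  have tt : (z + z ^+ 4) * (z ^+ 2 + z ^+ 3) = - 1.
    transitivity (z ^+ 3 + z ^+ 4 + z ^+ 5 * z + z ^+ 5 * z ^+ 2); first by ring.
    by rewrite z5 zE; ring.
  have ts : z + z ^+ 4 = - 1 - (z ^+ 2 + z ^+ 3) by rewrite zE; ring.
  rewrite E1 E2 z5.
  transitivity ((1 - x) * (1 - ((z + z ^+ 4) + (z ^+ 2 + z ^+ 3)) * x
    + (2%:R + (z + z ^+ 4) * (z ^+ 2 + z ^+ 3)) * x ^+ 2
    - ((z + z ^+ 4) + (z ^+ 2 + z ^+ 3)) * x ^+ 3 + x ^+ 4)); last by ring.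
  by rewrite tt ts; ring.
by rewrite (split_qpoch z) (split_qpoch (z ^+ 4)) -GE; ring.
Qed.

(** * Transfer to truncated power series *)

Section Morphism.
Variables (A B : comNzRingType) (f : {rmorphism A -> B}).

Lemma rmorph_geom N x : f (geom N x) = geom N (f x).
Proof. by rewrite rmorph_sum; apply: eq_bigr => i _; rewrite rmorphXn. Qed.

Lemma rmorph_crank_series N s t q :
  f (crank_series N s t q) = crank_series N (f s) (f t) (f q).
Proof.
rewrite rmorph_sum; apply: eq_bigr => a _; rewrite rmorphM rmorph_prod rmorphXn rmorphM.
congr (_ * _); apply: eq_bigr => i _; rewrite rmorph_geom.
by case: ifP => _; [rewrite rmorphXn | rewrite rmorphM rmorphXn].
Qed.
End Morphism.

Section TruncatedSeries.
Variables (R : comNzRingType) (N : nat).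
Notation A := {poly %/ ('X^(N.+2) : {poly R})}.
Notation trunc := (in_qpoly ('X^(N.+2) : {poly R})).

Lemma qX_nilpotent : trunc 'X ^+ N.+2 = 0.
Proof.
rewrite -rmorphXn; apply/val_inj; rewrite /= mk_monic_Xn.
by rewrite Pdiv.RingMonic.rmodpp // monicXn.
Qed.

(** This brings identities proved with [q] nilpotent back to coefficients: reduction modulo
    ['X^(N.+2)] loses none of degree below [N.+2]. *)
Lemma trunc_eqP (p r : {poly R}) : trunc p = trunc r ->
  forall m, (m < N.+2)%N -> p`_m = r`_m.
Proof.
have E (g : {poly R}) m : (m < N.+2)%N -> g`_m = (trunc g)`_m.
  move=> lt_m; rewrite /= mk_monic_Xn.
  rewrite {1}(Pdiv.RingMonic.rdivp_eq (monicXn R N.+2) g) coefD.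
  by rewrite coefMXn lt_m add0r.
by move=> e m lt_m; rewrite (E p) ?(E r) ?e.
Qed.
End TruncatedSeries.

(** * Codes of partitions and the exchange symmetry *)

(* [(a, f)] encodes a partition: [2 a] is its largest even part, and [2 f i] is
   the multiplicity of the even size [2 i + 2 < 2 a] and of the odd size
   [2 i + 1 > 2 a]; the size [2 a] itself has multiplicity [2 f (a - 1) + 1]. *)
Notation code K := ('I_K * {ffun 'I_K -> 'I_K})%type.

Section Codes.
Variable K : nat.
Implicit Type p : code K.

Definition half_even p : nat := p.1.
Definition half_odds p : nat := \sum_(i < K) (if (i < p.1)%N then 0 else p.2 i)%N.
Definition half_size p : nat :=
  (p.1 + \sum_(i < K) (if i < p.1 then (2 * i).+2 else (2 * i).+1) * p.2 i)%N.

Definition codes m : seq (code K) := [seq p <- enum {: code K} | half_size p == m].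

(** Expanding the product of geometric sums amounts to choosing an exponent [f i] in each factor. *)
Lemma crank_series_codes (A : comNzRingType) (s t q : A) :
  crank_series K s t q =
  \sum_p s ^+ half_even p * t ^+ half_odds p * q ^+ half_size p.
Proof.
rewrite -(pair_bigA _ (fun a f =>
  s ^+ half_even (a, f) * t ^+ half_odds (a, f) * q ^+ half_size (a, f))) /=.
apply: eq_bigr => a _; rewrite /geom bigA_distr_bigA mulr_sumr.
apply: eq_bigr => f _; rewrite /half_even /half_odds /half_size /=.
rewrite exprMn -[RHS]mulrA -[LHS]mulrA; congr (_ * _).
rewrite exprD mulrCA; congr (_ * _).
rewrite !expr_sum -big_split; apply: eq_bigr => i _ /=.
by case: ifP => _; [rewrite expr0 mul1r exprM | rewrite exprMn exprM].
Qed.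

Lemma coef_crank_series (R : comNzRingType) (s t : R) m :
  (crank_series K s%:P t%:P 'X)`_m =
  \sum_(p <- codes m) s ^+ half_even p * t ^+ half_odds p.
Proof.
rewrite big_filter big_enum_cond /=.
rewrite crank_series_codes coef_sum [RHS]big_mkcond; apply: eq_bigr => p _.
rewrite -!rmorphXn -rmorphM coefCM coefXn eq_sym.
by case: eqP => _; rewrite ?mulr1 ?mulr0.
Qed.
End Codes.


(** Both series become the same product after multiplication by the two denominators, which are
    invertible and merely exchanged. *)
Lemma crank_series_sym N (R : comNzRingType) (s t : R) m : (m < N.+2)%N ->
  (crank_series N.+2 s%:P t%:P 'X)`_m = (crank_series N.+2 t%:P s%:P 'X)`_m.
Proof.
apply: trunc_eqP.
pose f : {rmorphism {poly R} -> _} := in_qpoly ('X^(N.+2) : {poly R}).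
have q0 : f 'X ^+ N.+2 = 0 := qX_nilpotent R N.
rewrite -[LHS]/(f _) -[RHS]/(f _) !rmorph_crank_series.
set S := f s%:P; set T := f t%:P.
have x0 x : (x * f 'X) ^+ N.+2 = 0 by rewrite exprMn q0 mulr0.
apply: (@mulr_qpoch_inj _ N.+2 _ (f 'X ^+ 2) N.+2 (x0 S)).
apply: (@mulr_qpoch_inj _ N.+2 _ (f 'X ^+ 2) N.+2 (x0 T)).
rewrite /= -!mulrA [X in _ = _ * X]mulrC !crank_series_product //.
by rewrite [S * T]mulrC.
Qed.

Lemma perm_half_even_odds N m : (m < N.+2)%N ->
  perm_eq [seq (half_even p, half_odds p) | p <- codes N.+2 m]
          [seq (half_odds p, half_even p) | p <- codes N.+2 m].
Proof.
move=> lt_m.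
(* With [s] and [t] independent indeterminates, the coefficients count the codes with a given pair
   of statistics. *)
have E : \sum_(p <- codes N.+2 m) 'X ^+ half_odds p * ('X ^+ half_even p)%:P =
    \sum_(p <- codes N.+2 m) ('X ^+ half_odds p)%:P * 'X ^+ half_even p :> {poly {poly int}}.
  have := crank_series_sym ('X%:P : {poly {poly int}}) 'X lt_m.
  rewrite !coef_crank_series => E.
  transitivity (\sum_(p <- codes N.+2 m) 'X%:P ^+ half_even p * 'X ^+ half_odds p :
    {poly {poly int}}).
    by apply: eq_bigr => p _; rewrite mulrC rmorphXn.
  by rewrite E; apply: eq_bigr => p _; rewrite mulrC rmorphXn.
rewrite /perm_eq; apply/allP => -[x y] _ /=; rewrite !count_map.
have C (P : pred (code N.+2)) :
    (count P (codes N.+2 m))%:R = \sum_(p <- codes N.+2 m) (P p)%:R :> int.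
  by rewrite -sum1_count natr_sum big_mkcond; apply: eq_bigr => p _; case: (P p).
rewrite -(eqr_nat int) !C.
have := congr1 (fun g : {poly {poly int}} => g`_y`_x) E; rewrite !coef_sum => E'.
apply/eqP; etransitivity; [etransitivity; [|exact: E']|];
  apply: eq_bigr => p _; rewrite ?coefMC ?coefCM coefXn /= xpair_eqE.
- rewrite (eq_sym y); case: (half_odds p == y); last by rewrite andbF mul0r coef0.
  by rewrite andbT mul1r coefXn (eq_sym x).
- rewrite (eq_sym y) andbC; case: (half_even p == y); last by rewrite mulr0 coef0.
  by rewrite mulr1 coefXn (eq_sym x).
Qed.

Lemma big_half_even_odds_sym N m V (idx : V) (op : Monoid.com_law idx) (F : nat -> nat -> V) :
    (m < N.+2)%N ->
  \big[op/idx]_(p <- codes N.+2 m) F (half_even p) (half_odds p) =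
  \big[op/idx]_(p <- codes N.+2 m) F (half_odds p) (half_even p).
Proof.
move=> /perm_half_even_odds perm_L.
rewrite -(big_map (fun p => (half_even p, half_odds p)) xpredT (fun x => F x.1 x.2)) /=.
by rewrite (perm_big _ perm_L) big_map.
Qed.

(** * Coefficients at a fifth root of unity *)

(** The form has discriminant 5: a nonzero [y] would make 5 times a square a square, against the
    parity of the 5-adic valuation. *)
Lemma int_quadratic_eq0 (x y : int) : x ^+ 2 = x * y + y ^+ 2 -> x = 0 /\ y = 0.
Proof.
move=> E; have E5 : (2 * x - y) ^+ 2 = 5 * y ^+ 2.
  have -> : (2 * x - y) ^+ 2 = 4 * x ^+ 2 - 4 * x * y + y ^+ 2 by ring.
  by rewrite E; ring.
have y0 : y = 0.
  apply/eqP; apply: contraT => y_neq0.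
  have E' : (absz (2 * x - y)%R ^ 2 = 5 * absz y ^ 2)%N by rewrite -abszX E5 abszM abszX.
  have := congr1 (logn 5) E'; rewrite lognM ?expn_gt0 ?absz_gt0 ?y_neq0 // !lognX.
  by rewrite (@logn_prime 5 5) //=; lia.
split=> //; move: E; rewrite y0 mulr0 expr0n addr0 => /eqP.
by rewrite expf_eq0 => /eqP.
Qed.

Lemma binS2_mod5 i : ('C(i.+1, 2) %% 5 = nth 0 [:: 0; 1; 3; 1; 0] (i %% 5))%N.
Proof.
(* 3 is the inverse of 2 modulo 5. *)
have -> : ('C(i.+1, 2) %% 5 = (3 * (i %% 5) * (i %% 5).+1) %% 5)%N.
  have E : (3 * i * i.+1 = 'C(i.+1, 2) + 5 * 'C(i.+1, 2))%N.
    by have := mul_bin_diag i.+1 1; rewrite bin1; lia.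
  rewrite -[LHS](modnMDl 'C(i.+1, 2)) addnC [X in (_ + X)%N]mulnC -E.
  rewrite {1 2}(divn_eq i 5); set d := (i %/ 5)%N; set r := (i %% 5)%N.
  have -> : (3 * (d * 5 + r) * (d * 5 + r).+1
      = (3 * d * (d * 5 + r).+1 + 3 * r * d) * 5 + 3 * r * r.+1)%N by nia.
  by rewrite modnMDl.
have := ltn_pmod i (isT : 0 < 5)%N.
by case: (i %% 5)%N => [|[|[|[|[|]]]]].
Qed.

Section RootOfUnity.
Variables (R : comNzRingType) (z : R).
Hypothesis z0 : z ^+ 4 + z ^+ 3 + z ^+ 2 + z + 1 = 0.

Lemma expr_mod_quintic k : z ^+ k = z ^+ (k %% 5)%N.
Proof. by rewrite expr_mod // (quintic_root5 z0). Qed.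

(** Modulo 5, ['C(i.+1, 2)] is 0, 1 or 3. The total 4 forces [i] and [k] to be 2 modulo 5, where
    both factors vanish. The total 0 leaves either [i] equal to 2 modulo 5, with a zero factor, or
    [i] and [k] both in {0, 4} modulo 5, where [n] is 1 or -1. *)
Lemma theta_coefs i k :
  let c := (z ^+ 3 ^+ i - z ^+ 2 ^+ i.+1) * (z ^+ k - z ^+ 4 ^+ k.+1) in
  let e := (('C(i.+1, 2) + 2 * 'C(k.+1, 2)) %% 5)%N in
  (e = 4%N -> c = 0) /\
  (e = 0%N -> exists n : int, c = (1 - z ^+ 2) * (1 - z ^+ 4) * n%:~R).
Proof.
move=> c e.
have S5 a : (a.+1 %% 5 = (a %% 5).+1 %% 5)%N by rewrite -[a.+1]addn1 -[(a %% 5).+1]addn1 modnDml.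
have cE : c = (z ^+ (3 * (i %% 5)%N) - z ^+ (2 * (i %% 5)%N.+1)) *
    (z ^+ (k %% 5)%N - z ^+ (4 * (k %% 5)%N.+1)).
  rewrite /c -!exprM; congr ((_ - _) * (_ - _)); rewrite expr_mod_quintic [RHS]expr_mod_quintic.
  - by rewrite modnMmr.
  - by rewrite -modnMmr S5 modnMmr.
  - by rewrite modn_mod.
  - by rewrite -modnMmr S5 modnMmr.
have eE : e = ((nth 0 [:: 0; 1; 3; 1; 0] (i %% 5) + 2 * nth 0 [:: 0; 1; 3; 1; 0] (k %% 5)) %% 5)%N.
  by rewrite -!binS2_mod5 modnDml -modnDmr modnMmr modnDmr.
have := ltn_pmod k (isT : 0 < 5)%N; have := ltn_pmod i (isT : 0 < 5)%N.
move: cE eE; move: (c) (e) (i %% 5)%N (k %% 5)%N => c' e' r s -> ->.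
have z10 : z ^+ 10 = 1 by rewrite expr_mod_quintic.
have z12 : z ^+ 12 = z ^+ 2 by rewrite expr_mod_quintic.
have z20 : z ^+ 20 = 1 by rewrite expr_mod_quintic.
case: r => [|[|[|[|[|//]]]]] _; case: s => [|[|[|[|[|//]]]]] _; split=> //= _;
  rewrite ?z10 ?z12 ?z20 ?subrr ?mul0r ?expr0 ?expr1 //.
- by exists 1; rewrite mulr1.
- by exists (- 1); rewrite mulrN1; ring.
- by exists 0; rewrite mulr0.
- by exists 0; rewrite mulr0.
- by exists (- 1); rewrite mulrN1; ring.
- by exists 1; rewrite mulr1; ring.
Qed.

End RootOfUnity.

Lemma prod_geom_expand (A : comNzRingType) K (b : A) :
  \prod_(i < K) geom K (b * b ^+ i) =
  \sum_(g : {ffun 'I_K -> 'I_K}) b ^+ (\sum_(i < K) i.+1 * g i).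
Proof.
rewrite /geom bigA_distr_bigA; apply: eq_bigr => g _.
by rewrite expr_sum; apply: eq_bigr => i _; rewrite -exprS exprM.
Qed.

Section CrankAtRoot.
Variables (F : idomainType) (z : F).
Hypothesis z0 : z ^+ 4 + z ^+ 3 + z ^+ 2 + z + 1 = 0.
Hypothesis z2 : z ^+ 2 != 1.
Hypothesis z4 : z ^+ 4 != 1.

(** The inverse of (q^5; q^5) contributes only exponents divisible by 5, so [m] modulo 5 is fixed by
    the two theta exponents. *)
Lemma coef_crank_series_root N m : (m < N.+2)%N ->
  (1 - z ^+ 2) * (1 - z ^+ 4) * (crank_series N.+2 z%:P (z ^+ 4)%:P 'X)`_m =
  \sum_(i < N.+2) \sum_(k < N.+2) \sum_(g : {ffun 'I_N.+2 -> 'I_N.+2})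
     (-1) ^+ (i + k) * ((z ^+ 3 ^+ i - z ^+ 2 ^+ i.+1) * (z ^+ k - z ^+ 4 ^+ k.+1))
     * (m == 'C(i.+1, 2) + 2 * 'C(k.+1, 2) + 5 * (\sum_(i < N.+2) i.+1 * g i))%N%:R.
Proof.
move=> lt_m; rewrite -coefCM.
pose f : {rmorphism {poly F} -> _} := in_qpoly ('X^(N.+2) : {poly F}).
have q0 : f 'X ^+ N.+2 = 0 := qX_nilpotent F N.
pose S1 : {poly F} := \sum_(i < N.+2) (-1) ^+ i * 'X ^+ 'C(i.+1, 2)
   * (z%:P ^+ 3 ^+ i - z%:P ^+ 2 ^+ i.+1).
pose S2 : {poly F} := \sum_(k < N.+2) (-1) ^+ k * ('X ^+ 2) ^+ 'C(k.+1, 2)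
   * (z%:P ^+ k - z%:P ^+ 4 ^+ k.+1).
pose G : {poly F} := \prod_(i < N.+2) geom N.+2 ('X ^+ 5 * ('X ^+ 5) ^+ i).
rewrite (@trunc_eqP _ N _ (S1 * S2 * G)) //; last first.
  have fz0 : f z%:P ^+ 4 + f z%:P ^+ 3 + f z%:P ^+ 2 + f z%:P + 1 = 0.
    have : f (z ^+ 4 + z ^+ 3 + z ^+ 2 + z + 1)%:P = 0 by rewrite z0 polyC0 rmorph0.
    by rewrite !polyCD !polyC_exp polyC1 !rmorphD !rmorphXn rmorph1.
  have := crank_series_quintic q0 fz0.
  have fS1 : f S1 = \sum_(i < N.+2) (-1) ^+ i * f 'X ^+ 'C(i.+1, 2)
      * (f z%:P ^+ 3 ^+ i - f z%:P ^+ 2 ^+ i.+1).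
    rewrite rmorph_sum; apply: eq_bigr => i _.
    by rewrite rmorphM rmorphB !rmorphXn rmorphM rmorph_sign rmorphXn.
  have fS2 : f S2 = \sum_(i < N.+2) (-1) ^+ i * (f 'X ^+ 2) ^+ 'C(i.+1, 2)
      * (f z%:P ^+ i - f z%:P ^+ 4 ^+ i.+1).
    rewrite rmorph_sum; apply: eq_bigr => i _.
    by rewrite rmorphM rmorphB !rmorphXn rmorphM rmorph_sign !rmorphXn.
  have fG : qpoch (f 'X ^+ 5) (f 'X ^+ 5) N.+2 * f G = 1.
    have -> : f G = \prod_(i < N.+2) geom N.+2 (f 'X ^+ 5 * (f 'X ^+ 5) ^+ i).
      rewrite rmorph_prod; apply: eq_bigr => i _.
      by rewrite rmorph_geom rmorphM !rmorphXn.
    by apply: qpoch_mul_geom; rewrite exprAC q0 expr0n.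
  rewrite -fS1 -fS2 => E; rewrite -[LHS]/(f _) -[RHS]/(f _).
  rewrite [RHS](rmorphM f) [f (S1 * S2)](rmorphM f) -E -!mulrA fG mulr1.
  rewrite (rmorphM f) (rmorph_crank_series f) polyCM (rmorphM f) mulrA.
  by rewrite !polyCB !polyC1 !polyC_exp !(rmorphB f) !(rmorph1 f) !(rmorphXn f).
rewrite /G prod_geom_expand /S1 /S2 big_distrlr /=.
rewrite mulr_suml coef_sum; apply: eq_bigr => i _.
rewrite mulr_suml coef_sum; apply: eq_bigr => k _.
rewrite mulr_sumr coef_sum; apply: eq_bigr => g _.
set w := (\sum_(_ < _) _)%N.
have signC n : (-1) ^+ n = ((-1) ^+ n)%:P :> {poly F} by rewrite polyC_exp polyCN polyC1.
rewrite !signC -!polyC_exp -!polyCB -!exprM.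
transitivity ((((-1) ^+ i * (z ^+ (3 * i) - z ^+ (2 * i.+1))
    * ((-1) ^+ k * (z ^+ k - z ^+ (4 * k.+1))))%:P
  * 'X^('C(i.+1, 2) + 2 * 'C(k.+1, 2) + 5 * w))`_m).
  by apply: (congr1 (fun P : {poly F} => P`_m)); rewrite !exprD !polyCM; ring.
by rewrite coefCM coefXn exprD; ring.
Qed.

(** As [z ^+ 4] is the inverse of [z], the sum runs over [z] to the power
    [half_even p - half_odds p]. *)
Lemma crank_sum_root N m : (m < N.+2)%N ->
  let E := \sum_(p <- codes N.+2 m) z ^+ (half_even p + 4 * half_odds p) in
  ((m %% 5)%N = 4%N -> E = 0) /\ ((m %% 5)%N = 0%N -> exists n : int, E = n%:~R).
Proof.
move=> lt_m E.
have D0 : (1 - z ^+ 2) * (1 - z ^+ 4) != 0.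
  by rewrite mulf_neq0 // subr_eq0 eq_sym.
have := coef_crank_series_root lt_m; rewrite coef_crank_series.
have -> : \sum_(p <- codes N.+2 m) z ^+ half_even p * z ^+ 4 ^+ half_odds p = E.
  by apply: eq_bigr => p _; rewrite exprD exprM.
move=> DE; split=> m5.
  apply: (mulfI D0); rewrite mulr0 DE.
  apply: big1 => i _; apply: big1 => k _; apply: big1 => g _.
  case: eqP => [em | _]; last by rewrite mulr0.
  have [-> //] := theta_coefs z0 i k; first by rewrite mulr0 mul0r.
  by rewrite -[RHS]m5 em [in RHS]addnC [(5 * _)%N]mulnC modnMDl.
suff [n En] : exists n : int, (1 - z ^+ 2) * (1 - z ^+ 4) * E = (1 - z ^+ 2) * (1 - z ^+ 4) * n%:~R.
  by exists n; apply: (mulfI D0).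
rewrite DE; set D := (1 - z ^+ 2) * _.
(* Integer multiples of [D] are closed under addition, so each term can be treated alone. *)
pose Q x := exists n : int, x = D * n%:~R.
have Q0 : Q 0 by exists 0; rewrite mulr0.
have QD x y : Q x -> Q y -> Q (x + y).
  by move=> [a ->] [b ->]; exists (a + b); rewrite rmorphD mulrDr.
do 3![apply: (big_ind Q) => // ? _].
case: eqP => [em | _]; last by rewrite mulr0.
rewrite mulr1.
set i := (X in z ^+ 3 ^+ nat_of_ord X); set k := (X in z ^+ nat_of_ord X - _).
have [_ []] := theta_coefs z0 i k.
  by rewrite -[RHS]m5 em [in RHS]addnC [(5 * _)%N]mulnC modnMDl.
move=> n ->; exists ((-1) ^+ (i + k) * n).
by rewrite rmorphM rmorphXn rmorphN1 -/D; ring.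
Qed.
End CrankAtRoot.

(** * Equidistribution of the residue classes *)

Definition crank_class_count N m r : nat :=
  count (fun p => (half_even p + 4 * half_odds p) %% 5 == r)%N (codes N.+2 m).

Lemma crank_class_count_sym N m r : (m < N.+2)%N -> (r < 5)%N ->
  crank_class_count N m r = crank_class_count N m ((5 - r) %% 5)%N.
Proof.
move=> lt_m lt_r; rewrite /crank_class_count -!sum1_count.
rewrite !(big_mkcond (fun p => _ == _)) /=.
rewrite (@big_half_even_odds_sym N m _ _ _ (fun x y =>
  if ((x + 4 * y) %% 5)%N == r then 1%N else 0%N)) //.
apply: eq_bigr => p _; congr (if _ then _ else _).
by apply/eqP/eqP; lia.
Qed.

(** By the symmetry [P 1 = P 4] and [P 2 = P 3], so the sum at [z] is [P 0 - P 1 + (P 2 - P 1) * t]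
    with [t = z ^+ 2 + z ^+ 3]. If it is an integer [n], irrationality of [t] yields [P 1 = P 2] and
    [P 0 - n = P 1]. *)
Lemma crank_class_count_eq N m : (m < N.+2)%N ->
  let P := crank_class_count N m in
  ((m %% 5)%N = 0%N -> P 1%N = P 2%N) /\ ((m %% 5)%N = 4%N -> P 1%N = P 2%N /\ P 0%N = P 1%N).
Proof.
move=> lt_m P.
have [z prim_z] := C_prim_root_exists (isT : 0 < 5)%N.
have z1 k : (z ^+ k == 1) = (5 %| k)%N by rewrite -(prim_order_dvd prim_z).
have z0 : z ^+ 4 + z ^+ 3 + z ^+ 2 + z + 1 = 0.
  have /mulfI : z - 1 != 0 by rewrite subr_eq0 -[z]expr1 z1.
  apply; rewrite mulr0 -(subrr 1) -{3}(prim_expr_order prim_z); ring.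
have [E4 E0] := crank_sum_root z0 (negbT (z1 2)) (negbT (z1 4)) lt_m.
set E := \sum_(p <- _) _ in E4 E0.
have EP : E = \sum_(r < 5) (P r)%:R * z ^+ r.
  rewrite /P; under [RHS]eq_bigr => r _.
    rewrite /crank_class_count -sum1_count natr_sum mulr_suml big_mkcond. over.
  rewrite exchange_big; apply: eq_bigr => p _ /=.
  have lt5 := ltn_pmod (half_even p + 4 * half_odds p) (isT : 0 < 5)%N.
  rewrite (bigD1 (Ordinal lt5)) //= eqxx mul1r big1 => [|r].
    by rewrite addr0 (expr_mod_quintic z0).
  by rewrite -val_eqE eq_sym /= => /negbTE->.
have [P14 P23] : P 1%N = P 4%N /\ P 2%N = P 3%N.
  by split; apply: crank_class_count_sym.
have conclude (n : int) : E = n%:~R -> P 1%N = P 2%N /\ (P 0%N)%:Z - n = (P 1%N)%:Z.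
  move=> En; pose t := z ^+ 2 + z ^+ 3.
  pose x : int := (P 0%N)%:Z - n - (P 1%N)%:Z; pose y : int := (P 2%N)%:Z - (P 1%N)%:Z.
  have t2 : t ^+ 2 = 1 - t.
    rewrite /t; transitivity (z ^+ 5 * z + 2 * z ^+ 5 + z ^+ 4); first by ring.
    rewrite (quintic_root5 z0); apply/eqP; rewrite -subr_eq0 -z0; apply/eqP; ring.
  have xy : x%:~R + y%:~R * t = 0 :> algC.
    rewrite /x /y !intrB -En EP !big_ord_recl big_ord0 /= /bump /= !addn0 !add1n.
    rewrite -P14 -P23 /t -!pmulrn.
    transitivity (- (P 1%N)%:R * (z ^+ 4 + z ^+ 3 + z ^+ 2 + z + 1) : algC); first by ring.
    by rewrite z0 mulr0.
  have : x ^+ 2 = x * y + y ^+ 2.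
    apply: (@intr_inj algC); apply/eqP; rewrite -subr_eq0; apply/eqP.
    rewrite !expr2 intrD !intrM.
    (* The norm of [x + y * t]: the conjugate of [t] is [- 1 - t]. *)
    transitivity ((x%:~R + y%:~R * t) * (x%:~R + y%:~R * (- 1 - t)) : algC).
      transitivity (x%:~R ^+ 2 - x%:~R * y%:~R - y%:~R ^+ 2 * (t + t ^+ 2) : algC); last by ring.
      by rewrite t2; ring.
    by rewrite xy mul0r.
  case/int_quadratic_eq0; rewrite /x /y => x0 y0; split; lia.
split=> m5.
  by have [n /conclude[]] := E0 m5.
by have /conclude[-> ] : E = 0%:~R by [rewrite E4]; split=> //; lia.
Qed.

(** * The bijection between codes and partitions *)

Local Open Scope nat_scope.

Lemma count_flatten_nseq (I : Type) (r : seq I) (m w : I -> nat) (P : pred nat) :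
  count P (flatten [seq nseq (m i) (w i) | i <- r]) = (\sum_(i <- r) P (w i) * m i)%N.
Proof.
elim: r => [|i r IH] /=; first by rewrite big_nil.
by rewrite count_cat IH count_nseq big_cons.
Qed.

Lemma sumn_flatten_nseq (I : Type) (r : seq I) (m w : I -> nat) :
  sumn (flatten [seq nseq (m i) (w i) | i <- r]) = (\sum_(i <- r) w i * m i)%N.
Proof.
elim: r => [|i r IH] /=; first by rewrite big_nil.
by rewrite sumn_cat IH sumn_nseq big_cons.
Qed.

Lemma sumn_sort (s : seq nat) : sumn (sort geq s) = sumn s.
Proof. by apply/perm_sumn; rewrite perm_sort. Qed.

Lemma geq_total : total geq. Proof. by move=> x y; exact: leq_total. Qed.
Lemma geq_trans : transitive geq. Proof. by move=> y x z xy yz; exact: leq_trans yz xy. Qed.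
Lemma geq_anti : antisymmetric geq.
Proof. by move=> x y /andP[? ?]; apply/eqP; rewrite eqn_leq; apply/andP. Qed.

Lemma leq_largest_even l x : x \in l -> ~~ odd x -> x <= largest_even l.
Proof. by move=> x_in x_even; exact: (@leq_bigmax_seq _ l _ (fun y => y) x). Qed.

Lemma largest_even_mem l : 0 < largest_even l -> largest_even l \in l.
Proof.
rewrite /largest_even; elim: l => [|x l IH]; first by rewrite big_nil.
rewrite big_cons inE; set m := \big[_/_]_(_ <- _ | _) _ in IH *.
case: ifP => _; last by move/IH->; rewrite orbT.
by rewrite /maxn; case: ifP => _; [move/IH->; rewrite orbT | rewrite eqxx].
Qed.

Lemma largest_even_even l : ~~ odd (largest_even l).
Proof. by apply: (big_ind (fun x => ~~ odd x)) => // x y; rewrite /maxn; case: ifP. Qed.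

Lemma leq_mul_count_sumn (l : seq nat) x : x * count_mem x l <= sumn l.
Proof.
elim: l => [|y l IH] /=; first by rewrite muln0.
by rewrite mulnDr leq_add //; case: eqP => [->|_]; rewrite ?muln1 ?muln0.
Qed.

Section PartitionOfCode.
Variable K : nat.
Implicit Type p : code K.

Definition part_size p (i : nat) : nat := if (i < p.1)%N then (2 * i).+2 else (2 * i).+1.

Definition partition_of_code p : seq nat :=
  sort geq (nseq (0 < p.1)%N (2 * p.1)
    ++ flatten [seq nseq (2 * p.2 i) (part_size p i) | i <- enum 'I_K]).

Lemma part_size_inj p i j : part_size p i = part_size p j -> i = j.
Proof. by rewrite /part_size; case: ifP; case: ifP; lia. Qed.

Lemma odd_part_size p i : odd (part_size p i) = (p.1 <= i)%N.
Proof. by rewrite /part_size; case: ltnP => _; rewrite /= ?negbK mul2n odd_double. Qed.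

Lemma count_partition_of_code p (P : pred nat) :
  count P (partition_of_code p) =
  (P (2 * p.1) * (0 < p.1) + 2 * \sum_(i < K) P (part_size p i) * p.2 i)%N.
Proof.
rewrite count_sort count_cat count_nseq count_flatten_nseq big_enum /=.
by rewrite big_distrr /=; congr (_ + _)%N; apply: eq_bigr => i _; rewrite mulnCA.
Qed.

Lemma mem_partition_of_code p x : x \in partition_of_code p ->
  (0 < p.1)%N /\ x = (2 * p.1)%N \/ exists i, x = part_size p i.
Proof.
rewrite mem_sort mem_cat => /orP[|/flattenP[s /mapP[i _ ->]]].
  by rewrite mem_nseq => /andP[a0 /eqP->]; left; case: (val p.1) a0.
by rewrite mem_nseq => /andP[_ /eqP->]; right; exists i.
Qed.

Lemma largest_even_partition_of_code p :
  largest_even (partition_of_code p) = (2 * half_even p)%N.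
Proof.
apply/eqP; rewrite eqn_leq; apply/andP; split.
  apply/(bigmax_leqP_seq _ _ _ (fun x => x)) => x /mem_partition_of_code[[_ ->] // | [i ->]].
  by rewrite odd_part_size -ltnNge /part_size /half_even => lt_i; rewrite lt_i; lia.
rewrite /half_even; case: (posnP p.1) => [-> // | a0].
apply: leq_largest_even; last by rewrite mul2n odd_double.
by rewrite mem_sort mem_cat a0 /= inE eqxx.
Qed.

Lemma num_odd_parts_partition_of_code p :
  num_odd_parts (partition_of_code p) = (2 * half_odds p)%N.
Proof.
rewrite /num_odd_parts count_partition_of_code mul2n odd_double add0n.
congr (2 * _)%N; apply: eq_bigr => i _; rewrite odd_part_size ltnNge.
by case: (p.1 <= i)%N; rewrite ?mul1n ?mul0n.
Qed.

Lemma sumn_partition_of_code p : sumn (partition_of_code p) = (2 * half_size p)%N.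
Proof.
rewrite sumn_sort sumn_cat sumn_nseq sumn_flatten_nseq big_enum /= mulnDr big_distrr /=.
congr (_ + _)%N; first by case: (nat_of_ord p.1) => // a; rewrite muln1.
by apply: eq_bigr => i _; rewrite mulnCA.
Qed.

Lemma partition_of_code_in_EObar p :
  in_EObar (2 * half_size p) (partition_of_code p).
Proof.
apply/and3P; split.
- apply/and3P; split; last by rewrite sumn_partition_of_code.
    exact: sort_sorted geq_total _.
  apply/allP => x /mem_partition_of_code[[a0 ->] | [i ->]]; first by lia.
  by rewrite /part_size; case: ifP.
- apply/allP => x x_in; apply/allP => y y_in; apply/implyP => /andP[x_even y_odd].
  case/mem_partition_of_code: y_in y_odd => [[_ ->]|[j ->]].
    by rewrite mul2n odd_double.
  case/mem_partition_of_code: x_in x_even => [[_ ->] _|[i ->]]; rewrite !odd_part_size.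
    by rewrite /part_size; case: ifP; lia.
  by rewrite /part_size; case: ifP; case: ifP; lia.
- apply/allP => x x_in; rewrite largest_even_partition_of_code /half_even.
  rewrite count_partition_of_code oddD (oddM 2) addbF /= [x == _]eq_sym.
  case: (2 * _ =P x)%N => [E|]; last by rewrite mul0n.
  have [[-> _] //|[i Ei]] := mem_partition_of_code x_in.
  case: (posnP p.1) => // a0; move: Ei; rewrite -E /part_size; case: ifP; lia.
Qed.

Lemma partition_of_code_inj : injective partition_of_code.
Proof.
move=> [a f] [b g] E.
have ab : a = b.
  apply/val_inj; have := congr1 largest_even E.
  by rewrite !largest_even_partition_of_code /half_even /=; lia.
subst b; congr (_, _); apply/ffunP => i; apply/val_inj.
have := congr1 (count_mem (part_size (a, f) i)) E; rewrite !count_partition_of_code /=.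
have D h : (\sum_(j < K) (part_size (a, h) j == part_size (a, f) i) * h j = h i)%N.
  rewrite (bigD1 i) //= eqxx mul1n big1 ?addn0 // => j ne_ji.
  by case: eqP => // /part_size_inj/val_inj e; rewrite e eqxx in ne_ji.
by rewrite !D; lia.
Qed.

(** Halve the largest even part and the multiplicities; halving rounds down the one odd
    multiplicity. The bound [M < K] makes these values fit in ['I_K]. *)
Lemma partition_of_code_surj M l : (M < K)%N -> in_EObar (2 * M) l ->
  exists2 p, half_size p = M & partition_of_code p = l.
Proof.
move=> lt_MK /and3P[/and3P[sorted_l /allP pos_l /eqP sum_l] /allP EO_l /allP mult_l].
have le_l x : x \in l -> (x <= 2 * M)%N.
  rewrite -sum_l => x_in; rewrite (perm_sumn (perm_to_rem x_in)) /=; exact: leq_addr.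
have count_le x : 0 < x -> count_mem x l <= 2 * M.
  move=> x0; rewrite -sum_l -(leq_pmul2l x0).
  by apply: leq_trans (leq_mul_count_sumn l x) _; rewrite leq_pmull.
have max_even := largest_even_even l.
pose a := (largest_even l)./2.
have aE : (2 * a = largest_even l)%N by rewrite /a; lia.
have lt_aK : (a < K)%N.
  case: (posnP (largest_even l)) => [|/largest_even_mem/le_l]; lia.
(* [part_size] reads only the first component; the second one is a dummy. *)
pose f i := (count_mem (part_size (Ordinal lt_aK, [ffun=> Ordinal lt_aK]) i) l)./2.
have lt_fK i : (f i < K)%N.
  rewrite /f; have := count_le (part_size (Ordinal lt_aK, [ffun=> Ordinal lt_aK]) i).
  have -> : (0 < part_size (Ordinal lt_aK, [ffun=> Ordinal lt_aK]) i)%N.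
    by rewrite /part_size; case: ifP.
  by lia.
pose p : code K := (Ordinal lt_aK, [ffun i : 'I_K => Ordinal (lt_fK i)]).
have pE : partition_of_code p = l.
  apply: (sorted_eq geq_trans geq_anti) => //; first exact: sort_sorted geq_total _.
  rewrite /perm_eq; apply/allP => x _ /=; rewrite count_partition_of_code /= aE.
  have fE i : (p.2 i : nat) = (count_mem (part_size p i) l)./2 by rewrite ffunE.
  have [x_in | x_notin] := boolP (x \in l); last first.
    rewrite (count_memPn x_notin) big1 => [|i _].
      case: (largest_even l =P x) => [xE | _] //; case: (posnP a) => // a0; case/negP: x_notin.
      by rewrite -xE largest_even_mem // -aE; lia.
    by case: eqP => // Ei; rewrite fE Ei (count_memPn x_notin).
  (* An odd part [x] has index [x./2], which is at least [a] because [l] is in EO; an even one has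
     index [x./2 - 1], below [a]. *)
  have [i0 i0E] : exists i0 : 'I_K, part_size p i0 = x.
    have x0 := pos_l _ x_in; have xM := le_l _ x_in.
    have [x_odd | x_even] := boolP (odd x).
      have lt_x : x./2 < K by lia.
      exists (Ordinal lt_x); rewrite /part_size /=; case: ltnP => //; last by lia.
      case: (posnP a) => [-> // | a0].
      have /largest_even_mem/EO_l/allP/(_ x x_in) : 0 < largest_even l by lia.
      by rewrite max_even x_odd /=; lia.
    have := leq_largest_even x_in x_even => le_x.
    have lt_x : (x./2).-1 < K by lia.
    by exists (Ordinal lt_x); rewrite /part_size /=; case: ltnP; lia.
  rewrite (bigD1 i0) //= i0E eqxx mul1n big1 => [|j ne_j]; last first.
    by case: eqP => //; rewrite -i0E => /part_size_inj/val_inj e; rewrite e eqxx in ne_j.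
  rewrite fE i0E addn0 [_ == x]eq_sym -(eqP (mult_l x x_in)).
  have := odd_double_half (count_mem x l).
  have := pos_l x x_in; have := eqP (mult_l x x_in).
  case: (odd _) => [/esym/eqP xE x0 | _ _] countE; last by rewrite mul0n mul2n -[X in _ == X]countE.
  have -> : 0 < a by lia.
  by rewrite mul1n mul2n -[X in _ == X]countE.
exists p => //; have := sumn_partition_of_code p; rewrite pE sum_l; lia.
Qed.

End PartitionOfCode.

Lemma perm_partitions_codes K M : (M < K)%N ->
  perm_eq [seq bseq_parts s | s <- enum {: (2 * M).-bseq 'I_(2 * M).+1}
             & in_EObar (2 * M) (bseq_parts s)]
          [seq partition_of_code p | p <- codes K M].
Proof.
move=> lt_MK; apply: uniq_perm.
- by rewrite (map_inj_uniq (@bseq_parts_inj _)) filter_uniq // enum_uniq.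
- by rewrite (map_inj_uniq (@partition_of_code_inj _)) filter_uniq // enum_uniq.
move=> l; apply/mapP/mapP => [[s] | [p]]; rewrite mem_filter mem_enum andbT.
  move=> l_in ->; have [p pM <-] := partition_of_code_surj lt_MK l_in.
  by exists p; rewrite // mem_filter mem_enum pM eqxx.
move=> /eqP <- ->; have l_in := partition_of_code_in_EObar p.
have /andP[/partition_bseq[s sE] _] := l_in.
by exists s; rewrite ?sE // mem_filter mem_enum sE l_in.
Qed.

Lemma NTeo_codes K M (k : int) (m : nat) : (M < K)%N ->
  NTeo k m (2 * M) =
  (\sum_(p <- codes K M | ((2 * half_even p)%N%:Z - (2 * half_odds p)%N%:Z == k %[mod m])%Z)
     2 * half_odds p)%N.
Proof.
move=> lt_MK; rewrite /NTeo.
pose F l := if (eoc l == k %[mod m])%Z then num_odd_parts l else 0.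
transitivity (\sum_(l <- [seq bseq_parts s | s <- enum {: (2 * M).-bseq 'I_(2 * M).+1}
    & in_EObar (2 * M) (bseq_parts s)]) F l).
  rewrite big_map big_filter big_enum_cond /=.
  by rewrite big_mkcondr; apply: eq_bigl.
rewrite (perm_big _ (perm_partitions_codes lt_MK)) big_map [RHS]big_mkcond.
apply: eq_bigr => p _; rewrite /F /eoc num_odd_parts_partition_of_code.
by rewrite largest_even_partition_of_code.
Qed.

(** A pair of even parts adds an even amount to the half size, and a pair of odd parts an odd
    amount; hence the parity of [half_even p + half_odds p] is that of the half size. *)
Lemma half_size_parity K (p : code K) :
  exists d, half_size p = half_even p + half_odds p + 2 * d.
Proof.
exists (\sum_(i < K) (if i < p.1 then i.+1 else i) * p.2 i).
rewrite /half_size /half_even /half_odds -addnA; congr (_ + _).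
rewrite big_distrr -big_split; apply: eq_bigr => i _ /=.
by case: ifP => _; lia.
Qed.

(** * Divisibility by 5 and by powers of 2 *)

Section Assembly.
Variable M : nat.
Notation L := (codes M.+2 M).
Notation a p := (half_even p).
Notation j p := (half_odds p).
Let cls (x y : nat) := (x + 4 * y) %% 5.
(* The weights of the theorem, read off the residue [c] of [(largest even part -
   number of odd parts) / 2]: the crank is [2 c]. *)
Let chi (r : nat) : int := nth 0%R [:: 0; 2; -1; 1; -2]%R r.

Lemma crank_combination :
  ((((NTeo 1 5 (2 * M)%N)%:Z - (NTeo 4 5 (2 * M)%N)%:Z)
    + 2 * ((NTeo 2 5 (2 * M)%N)%:Z - (NTeo 3 5 (2 * M)%N)%:Z))
  = 2 * \sum_(p <- L) (j p)%:Z * chi (cls (a p) (j p)))%R.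
Proof.
rewrite !(NTeo_codes _ _ (leqW (ltnSn M))).
have Z (k : int) : ((\sum_(p <- L | ((2 * a p)%:Z - (2 * j p)%:Z == k %[mod 5])%Z) 2 * j p)%N%:Z
   = \sum_(p <- L) if ((2 * a p)%:Z - (2 * j p)%:Z == k %[mod 5])%Z then (2 * j p)%:Z else 0)%R.
  by rewrite (big_morph Posz PoszD (erefl _)) big_mkcond.
rewrite !Z -!sumrB !mulr_sumr -big_split /=; apply: eq_bigr => p _.
have C (k : int) (r : nat) :
    (k = 1 /\ r = 3%N \/ k = 4 /\ r = 2%N \/ k = 2 /\ r = 1%N \/ k = 3 /\ r = 4%N)%R ->
    ((2 * a p)%:Z - (2 * j p)%:Z == k %[mod 5])%Z%R = (cls (a p) (j p) == r).
  by rewrite /cls; move=> H; apply/eqP/eqP; lia.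
rewrite (C 1%R 3) ?(C 4%R 2) ?(C 2%R 1%N) ?(C 3%R 4%N); try tauto.
have := ltn_pmod (a p + 4 * j p) (isT : 0 < 5); rewrite -/(cls _ _).
case: (cls _ _) => [|[|[|[|[|]]]]] //= _; rewrite /chi /=; ring.
Qed.

(** Exchanging the statistics negates [chi]. Averaging replaces the weight by [j - a], whose residue
    modulo 5 depends only on the class. *)
Lemma crank_combination_antisym :
  (2 * \sum_(p <- L) (j p)%:Z * chi (cls (a p) (j p))
   = \sum_(p <- L) ((j p)%:Z - (a p)%:Z) * chi (cls (a p) (j p)))%R.
Proof.
have chiN x y : chi (cls y x) = (- chi (cls x y))%R.
  have lt5 := ltn_pmod (x + 4 * y) (isT : 0 < 5).
  have -> : cls y x = (5 - cls x y) %% 5 by rewrite /cls; lia.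
  by rewrite -/(cls x y) in lt5; move: (cls x y) lt5 => [|[|[|[|[|]]]]].
transitivity (\sum_(p <- L) (j p)%:Z * chi (cls (a p) (j p))
   + \sum_(p <- L) (a p)%:Z * chi (cls (j p) (a p)))%R.
  rewrite -(@big_half_even_odds_sym M M _ _ _ (fun x y => (y%:Z * chi (cls x y))%R)) //.
  by rewrite mulr2n mulrDl mul1r.
rewrite -big_split; apply: eq_bigr => p _ /=.
by rewrite chiN; ring.
Qed.

Lemma crank_class_countE r : ((crank_class_count M M r)%:Z =
  \sum_(p <- L) (cls (a p) (j p) == r)%:Z)%R.
Proof.
rewrite /crank_class_count -sum1_count (big_morph Posz PoszD (erefl _)) big_mkcond.
by apply: eq_bigr => p _; case: eqP.
Qed.

Lemma dvd5_crank_combination : M %% 5 = 0 \/ M %% 5 = 4 ->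
  (5 %| \sum_(p <- L) ((j p)%:Z - (a p)%:Z) * chi (cls (a p) (j p)))%Z%R.
Proof.
move=> M5; pose P (r : nat) : int := (crank_class_count M M r)%:Z.
have lt_M : M < M.+2 by lia.
have P12 : P 1 = P 2.
  by have [E0 E4] := crank_class_count_eq lt_M; rewrite /P; case: M5 => [/E0->|/E4[->]].
have P14 : P 1 = P 4 by rewrite /P (crank_class_count_sym lt_M).
have P23 : P 2 = P 3 by rewrite /P (crank_class_count_sym lt_M).
(* The coefficient of [P c] is [- c * chi c] modulo 5; as the four counts agree, the total is
   [10 * P 1]. *)
have : (5 %| 3 * P 1%N + 2 * P 2%N + 2 * P 3%N + 3 * P 4%N)%Z%R.
  by rewrite -P14 -P23 -P12; apply/dvdzP; exists (2 * P 1%N)%R; ring.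
set S := (\sum_(p <- L) _)%R; set T := (3 * _ + _ + _ + _)%R => T5.
suff D5 : (S - T)%R \in dvdz 5 by rewrite -[S](subrK T); exact: rpredD D5 T5.
rewrite /S /T /P !crank_class_countE !mulr_sumr -!big_split -sumrB.
apply: rpred_sum => p _ /=; rewrite -[_ \in _]/(_ %| _)%Z.
have lt5 : cls (a p) (j p) < 5 by exact: ltn_pmod.
have : (a p + 4 * j p) %% 5 = cls (a p) (j p) by [].
by move: (cls _ _) lt5 => [|[|[|[|[|]]]]] //= _; rewrite /chi /=; lia.
Qed.

(** Only the classes 2 and 3 have odd weight. The exchange moves class 3 onto class 2, so modulo 2
    the sum is that of [a + j] over class 2, hence [M * P 2]. For odd [M], [P 2 = P 0], and class 0
    has even size: there [a + j] is odd, so [a] and [j] differ and the exchange matches [a < j] with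
    [j < a]. *)
Lemma dvd4_crank_combination : M %% 5 = 4 ->
  (2 %| \sum_(p <- L) (j p)%:Z * chi (cls (a p) (j p)))%Z%R.
Proof.
move=> M5; pose P (r : nat) := crank_class_count M M r.
have lt_M : M < M.+2 by lia.
pose Y := \sum_(p <- L) (if cls (a p) (j p) == 2 then a p + j p else 0).
have YE : (Y%:Z = \sum_(p <- L)
    (if (cls (a p) (j p) == 2) || (cls (a p) (j p) == 3) then (j p)%:Z else 0))%R.
  transitivity (\sum_(p <- L) (if cls (a p) (j p) == 2 then (j p)%:Z else 0)
    + \sum_(p <- L) (if cls (a p) (j p) == 3 then (j p)%:Z else 0))%R.
    rewrite (@big_half_even_odds_sym M M _ _ _ (fun x y =>
      (if cls x y == 3 then y%:Z else 0)%R)) //.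
    rewrite -big_split /Y (big_morph Posz PoszD (erefl _)); apply: eq_bigr => p _ /=.
    have -> : (cls (j p) (a p) == 3) = (cls (a p) (j p) == 2).
      by apply/eqP/eqP; rewrite /cls; lia.
    by case: ifP; rewrite ?addr0 // PoszD addrC.
  rewrite -big_split; apply: eq_bigr => p _ /=.
  by case: eqP => [->|_] //=; rewrite ?addr0 ?add0r.
have YP : exists d, Y + 2 * d = M * P 2.
  have Ld p : p \in L -> exists d, M = a p + j p + 2 * d.
    by rewrite mem_filter => /andP[/eqP pM _]; have := half_size_parity p; rewrite pM.
  exists (\sum_(p <- L) (if cls (a p) (j p) == 2 then (M - (a p + j p))./2 else 0)).
  rewrite /P /crank_class_count -sum1_count !big_distrr /Y -big_split /= [RHS]big_mkcond /=.
  apply: eq_big_seq => p /Ld[d Md]; rewrite -/(cls _ _); case: ifP => _; last by rewrite muln0.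
  by lia.
have P0 : P 2 = 2 * \sum_(p <- L) ((cls (a p) (j p) == 0) && (a p < j p)) \/ ~~ odd M.
  have [M_odd | ] := boolP (odd M); last by right.
  left; have [_ /(_ M5)[E1 E0]] := crank_class_count_eq lt_M; rewrite /P -E1 -E0.
  rewrite mul2n -addnn [X in _ = _ + X](@big_half_even_odds_sym M M _ _ _ (fun x y =>
    (cls x y == 0) && (x < y) : nat)) //.
  rewrite /crank_class_count -sum1_count big_mkcond -big_split.
  apply: eq_big_seq => p.
  rewrite mem_filter -/(cls _ _) => /andP[/eqP pM _] /=; have [d] := half_size_parity p.
  rewrite pM => Md.
  have -> : (cls (j p) (a p) == 0) = (cls (a p) (j p) == 0) by apply/eqP/eqP; rewrite /cls; lia.
  by case: eqP => _ //=; lia.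
have Y2 : (Y%:Z \in dvdz 2)%R.
  rewrite -[_ \in _]/(_ %| _)%Z; case: YP => d Yd.
  have : ~~ odd (M * P 2) by rewrite oddM; case: P0 => [->|/negbTE->] //; rewrite oddM andbF.
  by lia.
set X := (\sum_(p <- L) _)%R; suff D2 : (X - Y%:Z)%R \in dvdz 2.
  by rewrite -[X](subrK Y%:Z%R); exact: rpredD D2 Y2.
rewrite YE -sumrB; apply: rpred_sum => p _ /=; rewrite -[_ \in _]/(_ %| _)%Z.
have := ltn_pmod (a p + 4 * j p) (isT : 0 < 5); rewrite -/(cls _ _).
by case: (cls _ _) => [|[|[|[|[|]]]]] //= _; rewrite /chi /=; lia.
Qed.
End Assembly.

Theorem theorem1p2 (n : nat) :
  ((((NTeo 1 5 (10 * n)%N)%:Z - (NTeo 4 5 (10 * n)%N)%:Z)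
    + 2 * ((NTeo 2 5 (10 * n)%N)%:Z - (NTeo 3 5 (10 * n)%N)%:Z))%R
     = 0 %[mod 10])%Z
  /\
  ((((NTeo 1 5 (10 * n + 8)%N)%:Z - (NTeo 4 5 (10 * n + 8)%N)%:Z)
    + 2 * ((NTeo 2 5 (10 * n + 8)%N)%:Z - (NTeo 3 5 (10 * n + 8)%N)%:Z))%R
     = 0 %[mod 20])%Z.
Proof.
split.
  (* The combination is [2 * X] and divisible by 5, hence by 10; in the second case [X] is also
     even, which gives 20. *)
  have -> : 10 * n = 2 * (5 * n) by lia.
  have M5 : (5 * n) %% 5 = 0 by lia.
  have := dvd5_crank_combination (or_introl M5).
  by rewrite -crank_combination_antisym crank_combination; set X := (\sum_(_ <- _) _)%R; lia.
have -> : 10 * n + 8 = 2 * (5 * n + 4) by lia.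
have M5 : (5 * n + 4) %% 5 = 4 by lia.
have := dvd4_crank_combination M5.
have := dvd5_crank_combination (or_intror M5).
by rewrite -crank_combination_antisym crank_combination; set X := (\sum_(_ <- _) _)%R; lia.
Qed.
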